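(* Let $A_0,A_1,A_2\in\mathbb{C}^{n,n}$, let $P(\lambda)=\lambda^3A_0+\lambda^2A_2+\lambda A_1+A_0$ be a cubic matrix polynomial and let $D$ be a nonempty open or closed subset of $\mathbb{C}$. If at least one of the following conditions holds: (a) the bivariate matrix polynomial $(z_1,z_2)\mapsto(z_1^3z_2^3+z_1^3+z_2^3)A_0+(z_1^2z_2^3+z_1^2)A_2+(z_1^3z_2+z_2)A_1+A_0$ is stable with respect to $D^2$ and $-1,\ \tfrac12-\tfrac{\sqrt3}{2}i,\ \tfrac12+\tfrac{\sqrt3}{2}i\notin D$; (b) the bivariate matrix polynomial $(z_1,z_2)\mapsto z_2^3A_0+z_1z_2A_2+z_2A_1+A_0$ is stable with respect to $D^2$ and $0\notin D$; (c) the bivariate matrix polynomial $(z_1,z_2)\mapsto z_1z_2^3A_0+z_1z_2^2A_2+z_2^2A_1+z_1A_0$ is stable with respect to $D^2$ and $0\notin D$; then the matrix polynomial $\lambda\mapsto P(\lambda)$ is hyperstable with respect to $D$.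
   Context: A bivariate matrix polynomial $Q(z_1,z_2)\in\mathbb{C}^{n,n}[z_1,z_2]$ is stable with respect to a nonempty set $\Omega\subseteq\mathbb{C}^2$ if for all $(w_1,w_2)\in \Omega$ and all $x\in\mathbb{C}^n\setminus\{0\}$ there exists $y\in\mathbb{C}^n\setminus\{0\}$ with $y^*Q(w_1,w_2)x\neq0$ (equivalently, $\det Q(w_1,w_2)\ne 0$ on $\Omega$). A univariate matrix polynomial $P(\lambda)\in\mathbb{C}^{n,n}[\lambda]$ is regular if $\det P(\lambda)\not\equiv0$. A regular $P(\lambda)$ is hyperstable with respect to a nonempty open or closed $D\subseteq\mathbb{C}$ if for every $x\in\mathbb{C}^n\setminus\{0\}$ there exists $y\in\mathbb{C}^n\setminus\{0\}$ such that $y^*P(\mu)x\neq0$ for all $\mu\in D$ (this condition forces regularity). *)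

(* Defs.v *)
From HB Require Import structures.
From mathcomp Require Import all_boot all_order all_algebra.
From mathcomp Require Import complex.
From mathcomp Require Import all_classical all_reals all_analysis.

Set Implicit Arguments.
Unset Strict Implicit.
Unset Printing Implicit Defensive.

Import Order.TTheory GRing.Theory Num.Theory numFieldNormedType.Exports.
Local Open Scope classical_set_scope.
Local Open Scope ring_scope.
Local Open Scope sesquilinear_scope.

(* [R[i]] has no topology of its own; seen as a [numClosedFieldType], it
   inherits the one given by the modulus. *)
Definition Cplx (R : realType) : numClosedFieldType := R[i].

Definition sesq (C : numClosedFieldType) (n : nat) (M : 'M[C]_n)
    (y x : 'cV[C]_n) : C :=
  (y ^t* *m M *m x) 0 0.

Definition mxpoly_eval (C : comNzRingType) (n : nat) (P : 'M[{poly C}]_n)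
    (w : C) : 'M[C]_n :=
  map_mx (fun p : {poly C} => p.[w]) P.

(* In [{poly {poly C}}], the inner variable is z_1 and the outer one is z_2. *)
Notation Z1 := ('X%:P : {poly {poly _}}).
Notation Z2 := ('X : {poly {poly _}}).

Definition bimxpoly_eval (C : comNzRingType) (n : nat)
    (Q : 'M[{poly {poly C}}]_n) (w1 w2 : C) : 'M[C]_n :=
  map_mx (fun p : {poly {poly C}} => p.[w2%:P].[w1]) Q.

Definition mxpolyC (C : comNzRingType) (n : nat) (A : 'M[C]_n) :
    'M[{poly C}]_n := map_mx (fun a : C => a%:P) A.

Definition bimxpolyC (C : comNzRingType) (n : nat) (A : 'M[C]_n) :
    'M[{poly {poly C}}]_n := map_mx (fun a : C => a%:P%:P) A.

Definition bistable (C : numClosedFieldType) (n : nat) (Omega : set (C * C))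
    (Q : 'M[{poly {poly C}}]_n) : Prop :=
  forall w1 w2 : C, Omega (w1, w2) ->
  forall x : 'cV[C]_n, x != 0 ->
  exists2 y : 'cV[C]_n, y != 0 & sesq (bimxpoly_eval Q w1 w2) y x != 0.

Definition regular_mxpoly (C : numClosedFieldType) (n : nat)
    (P : 'M[{poly C}]_n) : Prop := \det P != 0.

Definition hyperstable (C : numClosedFieldType) (n : nat) (D : set C)
    (P : 'M[{poly C}]_n) : Prop :=
  regular_mxpoly P /\
  forall x : 'cV[C]_n, x != 0 ->
  exists2 y : 'cV[C]_n, y != 0 &
    forall mu : C, D mu -> sesq (mxpoly_eval P mu) y x != 0.

Lemma mxpoly_evalZC (C : comNzRingType) (n : nat) (p : {poly C})
    (A : 'M[C]_n) (w : C) :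
  mxpoly_eval (p *: mxpolyC A) w = p.[w] *: A.
Proof. by apply/matrixP => i j; rewrite !mxE hornerM hornerC. Qed.

Lemma mxpoly_evalC (C : comNzRingType) (n : nat) (A : 'M[C]_n) (w : C) :
  mxpoly_eval (mxpolyC A) w = A.
Proof. by apply/matrixP => i j; rewrite !mxE hornerC. Qed.

Lemma mxpoly_evalD (C : comNzRingType) (n : nat) (P Q : 'M[{poly C}]_n)
    (w : C) :
  mxpoly_eval (P + Q) w = mxpoly_eval P w + mxpoly_eval Q w.
Proof. by apply/matrixP => i j; rewrite !mxE hornerD. Qed.

Lemma bimxpoly_evalZC (C : comNzRingType) (n : nat) (p : {poly {poly C}})
    (A : 'M[C]_n) (w1 w2 : C) :
  bimxpoly_eval (p *: bimxpolyC A) w1 w2 = p.[w2%:P].[w1] *: A.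
Proof. by apply/matrixP => i j; rewrite !mxE !hornerM !hornerC. Qed.

Lemma bimxpoly_evalC (C : comNzRingType) (n : nat) (A : 'M[C]_n) (w1 w2 : C) :
  bimxpoly_eval (bimxpolyC A) w1 w2 = A.
Proof. by apply/matrixP => i j; rewrite !mxE !hornerC. Qed.

Lemma bimxpoly_evalD (C : comNzRingType) (n : nat)
    (P Q : 'M[{poly {poly C}}]_n) (w1 w2 : C) :
  bimxpoly_eval (P + Q) w1 w2 = bimxpoly_eval P w1 w2 + bimxpoly_eval Q w1 w2.
Proof. by apply/matrixP => i j; rewrite !mxE !hornerD. Qed.

Lemma eval_Z1 (C : comNzRingType) (w1 w2 : C) :
  (Z1 : {poly {poly C}}).[w2%:P].[w1] = w1.
Proof. by rewrite hornerC hornerX. Qed.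

Lemma eval_Z2 (C : comNzRingType) (w1 w2 : C) :
  (Z2 : {poly {poly C}}).[w2%:P].[w1] = w2.
Proof. by rewrite hornerX hornerC. Qed.

(* Main.v *)
(* Fix [x].  Up to a nowhere vanishing scalar factor, [Q(s, t) x] has the form
   [u + f(s) v + g(t) w] on [D^2], where [u], [v], [w] are the vectors
   [A_0 x], [A_1 x], [A_2 x] in some order, and [P(t) x] is the restriction of
   this form to the diagonal.  A covector that works for every [t] then comes
   from a case analysis on the linear relations between [u], [v] and [w]. *)
Require Import Defs.
From mathcomp Require Import all_boot all_order all_algebra.
From mathcomp Require Import complex.
From mathcomp Require Import all_classical all_reals all_analysis.
From mathcomp Require Import ring.

Set Implicit Arguments.
Unset Strict Implicit.
Unset Printing Implicit Defensive.

Import Order.TTheory GRing.Theory Num.Theory numFieldNormedType.Exports.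
Local Open Scope classical_set_scope.
Local Open Scope ring_scope.

(** [u] lies in the row space of [A] exactly when [cokermx A] annihilates it; otherwise some column
    of [cokermx A] serves as [k]. *)
Lemma separating_covector (F : fieldType) (m n : nat) (A : 'M[F]_(m, n))
    (u : 'rV[F]_n) : ~~ (u <= A)%MS ->
  exists2 k : 'cV[F]_n, A *m k = 0 & (u *m k) 0 0 != 0.
Proof.
rewrite submxE => /rV0Pn[j uKj]; exists (col j (cokermx A)).
  by rewrite colE mulmxA mulmx_coker mul0mx.
by rewrite colE mulmxA -colE mxE.
Qed.

Lemma sub_col_mx_rVP (F : fieldType) (n : nat) (u v w : 'rV[F]_n) :
  (u <= col_mx v w)%MS -> exists a b : F, u = a *: v + b *: w.
Proof.
rewrite -addsmxE => /sub_addsmxP[[p q] /= ->]; exists (p 0 0), (q 0 0).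
by rewrite [p in LHS]mx11_scalar [q in LHS]mx11_scalar !mul_scalar_mx.
Qed.

(* A linear relation [u = a v + b w] turns [u + f v + g w] into
   [(a + f) v + (b + g) w].  If [v] and [w] are independent, the two coefficients cannot
   both have a zero, as [f] and [g] may be evaluated at different points. *)
Lemma uniform_covector (F : fieldType) (n : nat) (T : Type) (D : set T)
    (f g : T -> F) (u v w : 'rV[F]_n) :
  D !=set0 ->
  (forall s t, D s -> D t -> u + f s *: v + g t *: w != 0) ->
  exists k : 'cV[F]_n,
    forall t, D t -> ((u + f t *: v + g t *: w) *m k) 0 0 != 0.
Proof.
move=> [t0 Dt0] nz.
(* Outside the span of [v] and [w], a [k] killing both but not [u] makes the value a nonzero
   constant. *)
have [uvw|/separating_covector[k]] := boolP (u <= col_mx v w)%MS; last first.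
  rewrite mul_col_mx => /eqP; rewrite col_mx_eq0 => /andP[/eqP vk /eqP wk] uk.
  exists k => t _.
  by rewrite !mulmxDl -!scalemxAl vk wk !scaler0 !addr0.
have [a [b uE]] := sub_col_mx_rVP uvw.
have comb s t : u + f s *: v + g t *: w = (a + f s) *: v + (b + g t) *: w.
  by rewrite uE !scalerDl -[X in X = _]addrA addrACA.
(* If all diagonal values lie on one line, any covector not vanishing on its generator [e] works. *)
have collinear e : (forall t, exists c, u + f t *: v + g t *: w = c *: e) ->
    exists k : 'cV[F]_n,
      forall t, D t -> ((u + f t *: v + g t *: w) *m k) 0 0 != 0.
  move=> ce.
  have e_neq0 : e != 0.
    have [c cE] := ce t0; have := nz _ _ Dt0 Dt0.
    by rewrite cE scaler_eq0 negb_or => /andP[].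
  have : ~~ (e <= (0 : 'M[F]_n))%MS by rewrite submx0.
  move=> /separating_covector[k _ ek]; exists k => t Dt.
  have [c cE] := ce t; have := nz _ _ Dt Dt.
  rewrite cE -scalemxAl mxE scaler_eq0 negb_or => /andP[c0 _].
  by rewrite mulf_neq0.
have [/sub_rVP[c wE]|/separating_covector[k2 vk2 wk2]] := boolP (w <= v)%MS.
  apply: (collinear v) => t; exists (a + f t + (b + g t) * c).
  by rewrite comb wE scalerA -scalerDl.
have [/sub_rVP[c vE]|/separating_covector[k1 wk1 vk1]] := boolP (v <= w)%MS.
  apply: (collinear w) => t; exists ((a + f t) * c + (b + g t)).
  by rewrite comb vE scalerA -scalerDl.
(* A zero [s] of [a + f] leaves only [(b + g t) *: w] at [(s, t)], so [b + g] has no zero on [D],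
   and [k2], which kills [v] but not [w], works. Without such a zero, [k1] works. *)
have [[s Ds fs]|fN] := pselect (exists2 s, D s & a + f s = 0).
  exists k2 => t Dt; rewrite comb mulmxDl -!scalemxAl vk2 scaler0 add0r mxE.
  have := nz _ _ Ds Dt; rewrite comb fs scale0r add0r scaler_eq0 negb_or.
  by move=> /andP[bg _]; rewrite mulf_neq0.
exists k1 => t Dt; rewrite comb mulmxDl -!scalemxAl wk1 scaler0 addr0 mxE.
by rewrite mulf_neq0//; apply/eqP => ft; apply: fN; exists t.
Qed.

Lemma uniform_sesq (C : numClosedFieldType) (n : nat) (T : Type) (D : set T)
    (f g : T -> C) (U V W : 'M[C]_n) (x : 'cV[C]_n) :
  D !=set0 ->
  (forall s t, D s -> D t -> (U + f s *: V + g t *: W) *m x != 0) ->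
  exists2 y : 'cV[C]_n, y != 0 &
    forall t, D t -> sesq (U + f t *: V + g t *: W) y x != 0.
Proof.
move=> D0 nz.
have trE s t : ((U + f s *: V + g t *: W) *m x)^T =
    (U *m x)^T + f s *: (V *m x)^T + g t *: (W *m x)^T.
  by rewrite !mulmxDl -!scalemxAl !linearD !linearZ.
have [|k kP] := @uniform_covector C n T D f g (U *m x)^T (V *m x)^T (W *m x)^T D0.
  by move=> s t Ds Dt; rewrite -trE trmx_eq0; apply: nz.
(* [sesq] conjugates its first argument, so [k] is turned into a vector by conjugating its
   entries. *)
have sesqE M : sesq M (map_mx Num.conj k) x = ((M *m x)^T *m k) 0 0.
  have -> : (M *m x)^T *m k = (k^T *m (M *m x))^T by rewrite [RHS]trmx_mul trmxK.
  rewrite [RHS]mxE /sesq -mulmxA; congr ((_ *m _) 0 0).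
  by apply/matrixP => i j; rewrite !mxE conjCK.
have kN0 t : D t -> sesq (U + f t *: V + g t *: W) (map_mx Num.conj k) x != 0.
  by move=> Dt; rewrite sesqE trE kP.
exists (map_mx Num.conj k) => //.
have [t0 /kN0] := D0; apply: contraNneq => ->.
by rewrite /sesq trmx0 map_mx0 !mul0mx mxE.
Qed.

Lemma sesq_neq0 (C : numClosedFieldType) (n : nat) (M : 'M[C]_n)
    (y x : 'cV[C]_n) : sesq M y x != 0 -> M *m x != 0.
Proof. by apply: contraNneq => Mx; rewrite /sesq -mulmxA Mx mulmx0 mxE. Qed.

Lemma sesqZ (C : numClosedFieldType) (n : nat) (c : C) (M : 'M[C]_n)
    (y x : 'cV[C]_n) : sesq (c *: M) y x = c * sesq M y x.
Proof. by rewrite /sesq -scalemxAr -scalemxAl mxE. Qed.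

(** Regularity follows from the second clause: if [\det P] were zero, [P] would be singular at a
    point of [D], and no [y] could serve a kernel vector there. *)
Lemma nonempty_hyperstable (C : numClosedFieldType) (n : nat) (D : set C)
    (P : 'M[{poly C}]_n) : D !=set0 ->
  (forall x : 'cV[C]_n, x != 0 -> exists2 y : 'cV[C]_n, y != 0 &
    forall mu, D mu -> sesq (mxpoly_eval P mu) y x != 0) ->
  hyperstable D P.
Proof.
move=> [mu Dmu] H; split=> //; rewrite /regular_mxpoly; apply/eqP => detP0.
have : \det (mxpoly_eval P mu)^T == 0.
  have := det_map_mx (horner_eval mu) P.
  by rewrite det_tr detP0 /= /horner_eval horner0 => <-.
move=> /det0P[v v0 vP]; have [|y _ /(_ _ Dmu)/sesq_neq0] := H v^T.
  by rewrite trmx_eq0.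
by rewrite -[mxpoly_eval P mu]trmxK -trmx_mul vP trmx0 eqxx.
Qed.

(* Dividing [Q(s, t)] by [d s t] and [P(t)] by [e t] decouples the two
   variables of [Q] while keeping [P] on its diagonal. *)
Lemma hyperstable_decoupled (C : numClosedFieldType) (n : nat) (D : set C)
    (P : 'M[{poly C}]_n) (Q : 'M[{poly {poly C}}]_n) (U V W : 'M[C]_n)
    (d : C -> C -> C) (e f g : C -> C) :
  D !=set0 -> bistable (D `*` D) Q ->
  (forall s t, D s -> D t ->
    bimxpoly_eval Q s t = d s t *: (U + f s *: V + g t *: W)) ->
  (forall t, D t -> e t != 0) ->
  (forall t, D t -> mxpoly_eval P t = e t *: (U + f t *: V + g t *: W)) ->
  hyperstable D P.
Proof.
move=> D0 Qst QE e0 PE; apply: nonempty_hyperstable => // x x0.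
have [s t Ds Dt|y y0 yP] := @uniform_sesq C n C D f g U V W x D0.
  have [y _ /sesq_neq0] := Qst s t (conj Ds Dt) x x0.
  by rewrite QE// -scalemxAl scaler_eq0 negb_or => /andP[].
by exists y => // t Dt; rewrite PE// sesqZ mulf_neq0 ?e0 ?yP.
Qed.

(** Factor [z^3 + 1] as [z + 1] times [(z - 1/2)^2 + 3/4], a difference of two squares over [C]. *)
Lemma cubic_eqN1 (C : numClosedFieldType) (z : C) : z ^+ 3 + 1 = 0 ->
  [\/ z = - 1, z = 1 / 2 - sqrtC 3 / 2 * 'i | z = 1 / 2 + sqrtC 3 / 2 * 'i].
Proof.
move=> z3; have s2 := sqrtCK (3 : C); have i2 := sqrCi C.
have : (z + 1) * ((z - 1 / 2) ^+ 2 - (sqrtC 3 / 2 * 'i) ^+ 2) == 0.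
  by rewrite exprMn exprMn s2 i2 -z3; apply/eqP; field.
rewrite mulf_eq0 subr_eq0 eqf_sqr addr_eq0 => /or3P[]/eqP zE.
- exact: Or31.
- by apply: Or33; rewrite -zE addrC subrK.
- by apply: Or32; rewrite -zE addrC subrK.
Qed.

Theorem theorem5p2 (R : realType) (n : nat) (A0 A1 A2 : 'M[Cplx R]_n)
    (D : set (Cplx R)) (hD0 : D !=set0) (hD : open D \/ closed D)
    (h :
      [\/ bistable (D `*` D)
            ((Z1 ^+ 3 * Z2 ^+ 3 + Z1 ^+ 3 + Z2 ^+ 3) *: bimxpolyC A0
             + (Z1 ^+ 2 * Z2 ^+ 3 + Z1 ^+ 2) *: bimxpolyC A2
             + (Z1 ^+ 3 * Z2 + Z2) *: bimxpolyC A1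
             + bimxpolyC A0)
          /\ [/\ ~ D (- 1),
                 ~ D (1 / 2 - sqrtC 3 / 2 * 'i)
               & ~ D (1 / 2 + sqrtC 3 / 2 * 'i)],
          bistable (D `*` D)
            (Z2 ^+ 3 *: bimxpolyC A0
             + (Z1 * Z2) *: bimxpolyC A2
             + Z2 *: bimxpolyC A1
             + bimxpolyC A0)
          /\ ~ D 0
        | bistable (D `*` D)
            ((Z1 * Z2 ^+ 3) *: bimxpolyC A0
             + (Z1 * Z2 ^+ 2) *: bimxpolyC A2
             + Z2 ^+ 2 *: bimxpolyC A1
             + Z1 *: bimxpolyC A0)
          /\ ~ D 0]) :
  hyperstable D
    ('X^3 *: mxpolyC A0 + 'X^2 *: mxpolyC A2 + 'X *: mxpolyC A1 + mxpolyC A0).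
Proof.
have PE t : mxpoly_eval
      ('X^3 *: mxpolyC A0 + 'X^2 *: mxpolyC A2 + 'X *: mxpolyC A1 + mxpolyC A0) t
    = (t ^+ 3 + 1) *: A0 + t ^+ 2 *: A2 + t *: A1.
  rewrite !mxpoly_evalD !mxpoly_evalZC mxpoly_evalC !hornerXn hornerX.
  by apply/matrixP => i j; rewrite !mxE; ring.
case: h => [[Qst [Dr1 Dr2 Dr3]]|[Qst D00]|[Qst D00]].
(* The excluded points are the roots of [z^3 + 1], so the coefficient [(s^3 + 1)(t^3 + 1)] of [A0]
   can be divided out. *)
- have e0 t : D t -> t ^+ 3 + 1 != 0.
    by move=> Dt; apply/eqP => /cubic_eqN1[] tE; rewrite tE in Dt.
  apply: (hyperstable_decoupled (U := A0) (V := A2) (W := A1)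
    (d := fun s t => (s ^+ 3 + 1) * (t ^+ 3 + 1)) (e := fun t => t ^+ 3 + 1)
    (f := fun s => s ^+ 2 / (s ^+ 3 + 1)) (g := fun t => t / (t ^+ 3 + 1))
    hD0 Qst) => // [s t Ds Dt|t Dt].
    rewrite !bimxpoly_evalD !bimxpoly_evalZC bimxpoly_evalC.
    rewrite !(hornerD, hornerM, horner_exp, eval_Z1, eval_Z2, hornerX, hornerC).
    by apply/matrixP => i j; rewrite !mxE; field; rewrite !e0.
  by rewrite PE; apply/matrixP => i j; rewrite !mxE; field; rewrite e0.
(* Here the coefficient [t] of [A1] is divided out, leaving [s] on [A2]. *)
- have e0 t : D t -> t != 0 by move=> Dt; apply/eqP => tE; rewrite tE in Dt.
  apply: (hyperstable_decoupled (U := A1) (V := A2) (W := A0)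
    (d := fun _ t => t) (e := id) (f := id) (g := fun t => (t ^+ 3 + 1) / t)
    hD0 Qst) => // [s t Ds Dt|t Dt].
    rewrite !bimxpoly_evalD !bimxpoly_evalZC bimxpoly_evalC.
    rewrite !(hornerD, hornerM, horner_exp, eval_Z1, eval_Z2, hornerX, hornerC).
    by apply/matrixP => i j; rewrite !mxE; field; rewrite e0.
  by rewrite PE; apply/matrixP => i j; rewrite !mxE; field; rewrite e0.
(* Here the coefficient [s t^2] of [A2] is divided out, leaving [1/s] on [A1]. *)
- have e0 t : D t -> t != 0 by move=> Dt; apply/eqP => tE; rewrite tE in Dt.
  apply: (hyperstable_decoupled (U := A2) (V := A1) (W := A0)
    (d := fun s t => s * t ^+ 2) (e := fun t => t ^+ 2)
    (f := fun s => s^-1) (g := fun t => (t ^+ 3 + 1) / t ^+ 2)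
    hD0 Qst) => // [s t Ds Dt|t Dt|t Dt].
  + rewrite !bimxpoly_evalD !bimxpoly_evalZC.
    rewrite !(hornerD, hornerM, horner_exp, eval_Z1, eval_Z2, hornerX, hornerC).
    by apply/matrixP => i j; rewrite !mxE; field; rewrite !e0.
  + by rewrite expf_neq0 ?e0.
  + by rewrite PE; apply/matrixP => i j; rewrite !mxE; field; rewrite e0.
Qed.
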